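(* Let $n \geq 12$ and let $\mathcal{M}$ be a regular map of order $2^n$. Let $$R_1=\{ \rho_0^2, \rho_1^2, \rho_2^2, (\rho_0\rho_2)^2\},\qquad R_2=\{ \rho_0^2, \rho_1^2, \rho_2^2, (\rho_0\rho_2)^2,(\rho_0\rho_1)^{2^{n-3}}, (\rho_1\rho_2)^{2^{n-3}}\},$$ and define the groups $$G_1=\langle \rho_0, \rho_1, \rho_2 \mid R_1, (\rho_0\rho_1)^{2^{n-2}}, (\rho_1\rho_2)^{2^{n-2}}, (\rho_0\rho_1)^2(\rho_1\rho_2)^2 \rangle,$$ $$G_2=\langle \rho_0, \rho_1, \rho_2 \mid R_1, (\rho_0\rho_1)^{2^{n-2}}, (\rho_1\rho_2)^{2^{n-2}}, (\rho_0\rho_1)^2(\rho_1\rho_2)^2(\rho_1\rho_2)^{2^{n-3}}\rangle,$$ $$G_3=\langle \rho_0, \rho_1, \rho_2 \mid R_2, (\rho_0\rho_1)^4(\rho_1\rho_2)^4, [(\rho_0\rho_1)^2,\rho_2](\rho_0\rho_1)^4\rangle,$$ $$G_4=\langle \rho_0, \rho_1, \rho_2 \mid R_2, (\rho_0\rho_1)^4(\rho_1\rho_2)^4, [(\rho_0\rho_1)^2,\rho_2](\rho_0\rho_1)^4(\rho_1\rho_2)^{2^{n-4}}\rangle,$$ $$G_5=\langle \rho_0, \rho_1, \rho_2 \mid R_2, (\rho_0\rho_1)^4(\rho_1\rho_2)^4(\rho_1\rho_2)^{2^{n-4}}, [(\rho_0\rho_1)^2,\rho_2](\rho_0\rho_1)^4(\rho_1\rho_2)^{2^{n-4}}\rangle,$$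 $$G_6=\langle \rho_0, \rho_1, \rho_2 \mid R_2, (\rho_0\rho_1)^4(\rho_1\rho_2)^4(\rho_1\rho_2)^{2^{n-4}}, [(\rho_0\rho_1)^2,\rho_2](\rho_0\rho_1)^4\rangle.$$ Then: (1) $\mathcal{M}$ has type $\{2^{n-2},2^{n-2}\}$ if and only if $\mathrm{Aut}(\mathcal{M})\cong G_1$ or $G_2$; (2) $\mathcal{M}$ has type $\{2^{n-3},2^{n-3}\}$ if and only if $\mathrm{Aut}(\mathcal{M})\cong G_3$, $G_4$, $G_5$ or $G_6$.
   Context: A (finite) regular map $\mathcal{M}$ is identified with a finite group $\mathrm{Aut}(\mathcal{M})$, its automorphism group, together with an ordered triple of generators $(r_0,r_1,r_2)$ of it such that $r_0,r_1,r_2$ and $r_0r_2$ all have order exactly $2$. The order of the regular map is $|\mathrm{Aut}(\mathcal{M})|$ (the number of flags of the map). The map has type $\{m,l\}$ if $r_0r_1$ has order exactly $m$ (the face length) and $r_1r_2$ has order exactly $l$ (the vertex valency). The symbol $\cong$ denotes isomorphism of groups. $[x,y]=x^{-1}y^{-1}xy$. In a presentation $\langle X\mid R\rangle$, the elements of $R$ are words set equal to $1$.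
   Formalization: Aut(M) ≅ G_i is taken as an isomorphism sending (r_0,r_1,r_2) to (ρ_0,ρ_1,ρ_2); for abstract group isomorphism ''if'' fails: (ρ_0ρ_2, ρ_1, ρ_2) makes G_1 the automorphism group of a map of type {2, 2^{n-2}}. *)

(* Defs.v *)
From HB Require Import structures.
From mathcomp Require Import all_boot fingroup.
From mathcomp Require Import boolp.
Set Implicit Arguments.
Unset Strict Implicit.
Unset Printing Implicit Defensive.

Local Open Scope group_scope.

Record regular_map := RegularMap {
  Aut_map : finGroupType;
  map_r0 : Aut_map;
  map_r1 : Aut_map;
  map_r2 : Aut_map;
  map_gen : <<[set map_r0; map_r1; map_r2]>> = [set: Aut_map];
  map_order0 : #[map_r0] = 2;
  map_order1 : #[map_r1] = 2;
  map_order2 : #[map_r2] = 2;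
  map_order02 : #[map_r0 * map_r2] = 2
}.

Definition map_order (M : regular_map) : nat := #|[set: Aut_map M]|.

Definition has_type (M : regular_map) (m l : nat) : Prop :=
  #[map_r0 M * map_r1 M] = m /\ #[map_r1 M * map_r2 M] = l.

(** Unreduced group words in three letters: [(i, false)] is the [i]-th
    generator and [(i, true)] its formal inverse.  They form a monoid with
    involution, so that relators can be written with the usual notations. *)
Definition word : Type := seq ('I_3 * bool).
HB.instance Definition _ := Choice.on word.

Definition word_mul (u v : word) : word := u ++ v.
Definition word_inv (u : word) : word := rev [seq (l.1, ~~ l.2) | l <- u].

Fact word_mulA : associative word_mul. Proof. exact: catA. Qed.
Fact word_mul1 : left_id ([::] : word) word_mul. Proof. exact: cat0s. Qed.
Fact word_invK : involutive word_inv.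
Proof.
move=> u; rewrite /word_inv map_rev revK -map_comp.
by rewrite -[RHS]map_id; apply: eq_map => -[i b] /=; rewrite negbK.
Qed.
Fact word_invM : {morph word_inv : u v / word_mul u v >-> word_mul v u}.
Proof. by move=> u v; rewrite /word_inv /word_mul map_cat rev_cat. Qed.

HB.instance Definition _ :=
  isStarMonoid.Build word word_mulA word_mul1 word_invK word_invM.

Definition letter (i : 'I_3) : word := [:: (i, false)].

(** The congruence on words defining the group < x_0, x_1, x_2 | R >. *)
Inductive word_eq (R : seq word) : word -> word -> Prop :=
  | WordRefl u : word_eq R u u
  | WordSym u v : word_eq R u v -> word_eq R v u
  | WordTrans u v w : word_eq R u v -> word_eq R v w -> word_eq R u w
  | WordMul u u' v v' :
      word_eq R u u' -> word_eq R v v' -> word_eq R (u * v) (u' * v')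
  | WordInv u : word_eq R (u^-1 * u) 1
  | WordRelator r : r \in R -> word_eq R r 1.

Section Presented.
Variable R : seq word.

Definition word_eqb (u v : word) : bool := `[< word_eq R u v >].

Fact word_eqb_refl : reflexive word_eqb.
Proof. by move=> u; apply/asboolP; exact: WordRefl. Qed.
Fact word_eqb_sym : symmetric word_eqb.
Proof. by move=> u v; apply/asboolP/asboolP => ?; exact: WordSym. Qed.
Fact word_eqb_trans : transitive word_eqb.
Proof.
move=> v u w /asboolP uv /asboolP vw; apply/asboolP; exact: WordTrans uv vw.
Qed.

Canonical word_equiv :=
  EquivRel word_eqb word_eqb_refl word_eqb_sym word_eqb_trans.

Local Open Scope quotient_scope.

Definition presented : Type := {eq_quot word_equiv}.
HB.instance Definition _ := Choice.on presented.
HB.instance Definition _ := EqQuotient.on presented.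

(* [repr] alone denotes the representative of a set in fingroup. *)
Local Notation quot_repr := generic_quotient.repr.

Definition class_of (u : word) : presented := \pi_presented u.

Fact class_ofP (u v : word) : class_of u = class_of v <-> word_eq R u v.
Proof. by split=> [/eqmodP/asboolP|/asboolP e] //; apply/eqmodP. Qed.

Fact repr_class_of (u : word) : word_eq R (quot_repr (class_of u)) u.
Proof. by apply/class_ofP; rewrite /class_of reprK. Qed.

Definition pres_mul (x y : presented) : presented :=
  class_of (quot_repr x * quot_repr y).
Definition pres_inv (x : presented) : presented := class_of (quot_repr x)^-1.
Definition pres_one : presented := class_of 1.

Fact word_eq_inv (u v : word) : word_eq R u v -> word_eq R u^-1 v^-1.
Proof.
move=> uv.
have vV : word_eq R (v * v^-1) 1 by have := WordInv R v^-1; rewrite invgK.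
apply: (@WordTrans _ _ (u^-1 * (v * v^-1))).
  rewrite -{1}[u^-1]mulg1; apply: WordMul; first exact: WordRefl.
  exact: WordSym.
rewrite mulgA -[X in word_eq R _ X]mul1g; apply: WordMul; last exact: WordRefl.
apply: (WordTrans _ (WordInv R u)).
by apply: WordMul; [exact: WordRefl | exact: WordSym].
Qed.

Fact class_ofM (u v : word) : pres_mul (class_of u) (class_of v) = class_of (u * v).
Proof. by apply/class_ofP; apply: WordMul; exact: repr_class_of. Qed.

Fact class_ofV (u : word) : pres_inv (class_of u) = class_of u^-1.
Proof. by apply/class_ofP; apply: word_eq_inv; exact: repr_class_of. Qed.

Fact class_of_repr (x : presented) : class_of (quot_repr x) = x.
Proof. exact: reprK. Qed.

Fact pres_mulA : associative pres_mul.
Proof.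
move=> x y z; rewrite -(class_of_repr x) -(class_of_repr y) -(class_of_repr z).
by rewrite !class_ofM mulgA.
Qed.
Fact pres_mul1 : left_id pres_one pres_mul.
Proof. by move=> x; rewrite -(class_of_repr x) class_ofM mul1g. Qed.
Fact pres_mulr1 : right_id pres_one pres_mul.
Proof. by move=> x; rewrite -(class_of_repr x) class_ofM mulg1. Qed.
Fact pres_mulV : left_inverse pres_one pres_inv pres_mul.
Proof.
move=> x; rewrite -(class_of_repr x) class_ofV class_ofM.
by apply/class_ofP; exact: WordInv.
Qed.
Fact pres_mulrV : right_inverse pres_one pres_inv pres_mul.
Proof.
move=> x; rewrite -(class_of_repr x) class_ofV class_ofM.
by apply/class_ofP; have := WordInv R (quot_repr x)^-1; rewrite invgK.
Qed.

HB.instance Definition _ := isGroup.Build presented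
  pres_mulA pres_mul1 pres_mulr1 pres_mulV pres_mulrV.

End Presented.

(** Isomorphism of [Aut M], as a group with its distinguished generating
    triple, with a presented group and its triple of generators.  The triple
    is part of the data of a regular map and cannot be forgotten here: for
    instance if [M] has type {2^(n-2), 2^(n-2)} and (r0 r1)^2 (r1 r2)^2 = 1,
    then (r0 r2, r1, r2) makes the same group the automorphism group of a
    regular map of type {2, 2^(n-2)}. *)
Definition Aut_iso (M : regular_map) (R : seq word) : Prop :=
  exists f : {multiplicative Aut_map M -> presented R},
    [/\ bijective f,
        f (map_r0 M) = class_of R (letter (inord 0)),
        f (map_r1 M) = class_of R (letter (inord 1)) &
        f (map_r2 M) = class_of R (letter (inord 2))].

Section Relators.
Variable n : nat.

Local Notation rho0 := (letter (inord 0)).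
Local Notation rho1 := (letter (inord 1)).
Local Notation rho2 := (letter (inord 2)).

Definition R1 : seq word :=
  [:: rho0 ^+ 2; rho1 ^+ 2; rho2 ^+ 2; (rho0 * rho2) ^+ 2].

Definition R2 : seq word :=
  [:: rho0 ^+ 2; rho1 ^+ 2; rho2 ^+ 2; (rho0 * rho2) ^+ 2;
      (rho0 * rho1) ^+ (2 ^ (n - 3)); (rho1 * rho2) ^+ (2 ^ (n - 3))].

Definition G1_rel : seq word := R1 ++
  [:: (rho0 * rho1) ^+ (2 ^ (n - 2));
      (rho1 * rho2) ^+ (2 ^ (n - 2));
      (rho0 * rho1) ^+ 2 * (rho1 * rho2) ^+ 2].

Definition G2_rel : seq word := R1 ++
  [:: (rho0 * rho1) ^+ (2 ^ (n - 2));
      (rho1 * rho2) ^+ (2 ^ (n - 2));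
      (rho0 * rho1) ^+ 2 * (rho1 * rho2) ^+ 2 * (rho1 * rho2) ^+ (2 ^ (n - 3))].

Definition G3_rel : seq word := R2 ++
  [:: (rho0 * rho1) ^+ 4 * (rho1 * rho2) ^+ 4;
      [~ (rho0 * rho1) ^+ 2, rho2] * (rho0 * rho1) ^+ 4].

Definition G4_rel : seq word := R2 ++
  [:: (rho0 * rho1) ^+ 4 * (rho1 * rho2) ^+ 4;
      [~ (rho0 * rho1) ^+ 2, rho2] * (rho0 * rho1) ^+ 4
        * (rho1 * rho2) ^+ (2 ^ (n - 4))].

Definition G5_rel : seq word := R2 ++
  [:: (rho0 * rho1) ^+ 4 * (rho1 * rho2) ^+ 4 * (rho1 * rho2) ^+ (2 ^ (n - 4));
      [~ (rho0 * rho1) ^+ 2, rho2] * (rho0 * rho1) ^+ 4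
        * (rho1 * rho2) ^+ (2 ^ (n - 4))].

Definition G6_rel : seq word := R2 ++
  [:: (rho0 * rho1) ^+ 4 * (rho1 * rho2) ^+ 4 * (rho1 * rho2) ^+ (2 ^ (n - 4));
      [~ (rho0 * rho1) ^+ 2, rho2] * (rho0 * rho1) ^+ 4].

End Relators.

(* Main.v *)
From HB Require Import structures.
Require Import Defs.
From mathcomp Require Import all_boot fingroup.
From mathcomp Require Import morphism quotient.
From mathcomp Require Import pgroup cyclic gseries maximal.

(** Write a = r0 r1, b = r1 r2, and c = a^2, d = b^2.  Both parts are the same
    statement for (q, m) = (2, 2^(n-3)) and (q, m) = (4, 2^(n-4)): the group G
    has order 4qm, the type is {2m, 2m}, and the relators say that a^q b^q and
    [a^2, r2] a^4 are trivial up to factors z^e and z^e', where z = b^m is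
    an involution ([twist_relations]; for q = 2 necessarily e' = 0).

    The relations give the order.  The conjugate of c by r2 and the element
    b^q are powers of c, so <c> is normal and every element can be written
    r0^i r1^j b^k c^l with i, j < 2, k < q, l < m ([normal_form]).  A
    presented group therefore has at most 4qm elements, which makes its
    surjection onto a map group of order 4qm with the same relations an
    isomorphism.  The same count in a group of order exactly 4qm forces c to
    have order m, hence a and b to have order 2m.  In particular it is never
    necessary to exhibit a model of the presented groups.

    Conversely let a and b have order 2m in G.  The dihedral group <r0, r1>
    has index at most 4 in the 2-group G, so the squares of its elements lie in
    all its conjugates; thus <c> is normal, and so is <d> ([sqr_cycle_normal]).  As r0
    acts on <d> by a power map and r1 by inversion, c = (r0 r1)^2 commutes with
    d.  Next, b^q lies in <c>: otherwise the image of b in G / <c>, a group of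
    order 4q, has order at least 2q and is self-centralising; but the image
    of r0 commutes with it, so r0 lies in <b><c> and centralises d, although it
    inverts c^(4q), a power of d of order greater than 2
    ([pow_mem_sqr_cycle]).  By symmetry a^q lies in <d>.  Hence [c, b] and [d, a] square to 1 in cyclic
    groups whose only involution is z, and the relation (ab)^2 = 1, in the form
    a^b = b^-2 a^-1, turns this into the two relators ([sqr_sqr_twist],
    [order_twist]). *)
Set Implicit Arguments.
Unset Strict Implicit.
Unset Printing Implicit Defensive.

Local Open Scope group_scope.

(** * Products of two involutions and normal forms *)

(** Generation as a monoid, in the form of an induction principle; for
    involutions this is generation as a group.  It applies to a presented group,
    which is not known to be finite. *)
Definition generated_by (G : groupType) (x0 x1 x2 : G) : Prop :=
  forall P : G -> Prop, P 1 ->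
    (forall x, P x -> P (x0 * x)) -> (forall x, P x -> P (x1 * x)) ->
    (forall x, P x -> P (x2 * x)) -> forall x, P x.

Lemma involV (G : groupType) (x : G) : x ^+ 2 = 1 -> x^-1 = x.
Proof. by move=> xx; apply: mulg1_eq. Qed.

Lemma involK (G : groupType) (x y : G) : x ^+ 2 = 1 -> y * x * x = y.
Proof. by move=> xx; rewrite -mulgA -expg2 xx mulg1. Qed.

Lemma conj_invol_mull (G : groupType) (x y : G) :
  x ^+ 2 = 1 -> y ^+ 2 = 1 -> (x * y) ^ x = (x * y)^-1.
Proof. by move=> xx yy; rewrite conjgE invgM !involV // !mulgA -expg2 xx mul1g. Qed.

Lemma conj_invol_mulr (G : groupType) (x y : G) :
  x ^+ 2 = 1 -> y ^+ 2 = 1 -> (x * y) ^ y = (x * y)^-1.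
Proof.
by move=> xx yy; rewrite conjgE invgM !involV // -!mulgA -expg2 yy mulg1.
Qed.

Lemma expg_mod_nat (G : groupType) (x : G) m k : x ^+ m = 1 -> x ^+ (k %% m) = x ^+ k.
Proof.
by move=> xm; rewrite {2}(divn_eq k m) expgnDr mulnC expgnA xm expg1n mul1g.
Qed.

Lemma expgV_nat (G : groupType) (x : G) m : 0 < m -> x ^+ m = 1 -> x^-1 = x ^+ m.-1.
Proof. by case: m => // m _ xm; apply: mulg1_eq; rewrite -expgS. Qed.

(** The set of these products is stable under left multiplication by the
    three generators: <c> is normal, x1 x0 = x0 x1 c^-1, x2 commutes with x0,
    and x2 and x2 x1 are x1 b and b^-1. *)
Lemma normal_form (G : groupType) (x0 x1 x2 : G) (q m s t : nat) :
    generated_by x0 x1 x2 -> x0 ^+ 2 = 1 -> x1 ^+ 2 = 1 -> x2 ^+ 2 = 1 ->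
    (x0 * x2) ^+ 2 = 1 -> 0 < q -> 0 < m ->
    let c := (x0 * x1) ^+ 2 in let b := x1 * x2 in
    c ^ x2 = c ^+ s -> b ^+ q = c ^+ t -> c ^+ m = 1 ->
  forall x, exists u : bool * bool * 'I_q * 'I_m,
    x = x0 ^+ u.1.1.1 * x1 ^+ u.1.1.2 * b ^+ u.1.2 * c ^+ u.2.
Proof.
move=> gen x00 x11 x22 x02 q0 m0 c b cx2 bq cm.
have x0V := involV x00; have x1V := involV x11; have x2V := involV x22.
have cV : c^-1 = c ^+ m.-1 by apply: expgV_nat.
have cJ h l : exists l', (c ^+ l) ^ h = c ^+ l'.
  move: h l; apply: gen => [l|x IH l|x IH l|x IH l]; first by exists l; rewrite conjg1.
  - rewrite conjgM [in X in X ^ x]conjXg /c conjXg conj_invol_mull // expVgn -/c.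
    by rewrite cV -expgnA.
  - rewrite conjgM [in X in X ^ x]conjXg /c conjXg conj_invol_mulr // expVgn -/c.
    by rewrite cV -expgnA.
  - by rewrite conjgM [in X in X ^ x]conjXg cx2 -expgnA.
have bqm : b ^+ (q * m) = 1 by rewrite expgnA bq expgnAC cm expg1n.
have bV : b^-1 = b ^+ (q * m).-1 by apply: expgV_nat; rewrite ?muln_gt0 ?q0.
have x0x2 : x2 * x0 = x0 * x2.
  by move: (involV x02); rewrite invgM x0V x2V.
(* It suffices to have unbounded exponents [k] and [l]: [b ^+ q] is a power of [c]. *)
suff form x : exists i j : bool, exists k l : nat,
    x = x0 ^+ i * x1 ^+ j * b ^+ k * c ^+ l.
  move=> x; have [i [j [k [l ->]]]] := form x.
  exists (i, j, Ordinal (ltn_pmod k q0), Ordinal (ltn_pmod (t * (k %/ q) + l) m0)) => /=.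
  rewrite (expg_mod_nat _ cm) expgnDr [c ^+ (t * _)]expgnA -bq -(expgnA b).
  rewrite !mulgA -(mulgA _ (b ^+ (k %% q))) -(expgnDr b).
  by rewrite (addnC (k %% q)) mulnC -divn_eq.
have flip (y : G) (i : bool) : y ^+ 2 = 1 -> y * y ^+ i = y ^+ (~~ i).
  by case: i; rewrite ?expg0 ?expg1 ?mulg1 // -expg2.
have x1x0 : x1 * x0 = x0 * x1 * c^-1.
  by rewrite /c expg2 !invgM x0V x1V !mulgA (involK _ x11) -expg2 x00 mul1g.
move: x; apply: gen => [|x|x|x].
- by exists false, false, 0, 0; rewrite !expg0 !mulg1.
- by case=> i [j [k [l ->]]]; exists (~~ i), j, k, l; rewrite !mulgA flip.
- case=> [[]] [j [k [l ->]]]; last first.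
    by exists false, (~~ j), k, l; rewrite !expg0 !mul1g !mulgA flip.
  have [l' El] := cJ (x1 ^+ j * b ^+ k) m.-1.
  exists true, (~~ j), k, (l' + l); rewrite expgnDr -El -cV expg1 -flip // !mulgA.
  congr (_ * _); rewrite -!mulgA (mulgA x1 x0) x1x0 -!mulgA; do 2!congr (_ * _).
  by rewrite [RHS]mulgA mulVKg.
- have x2i (i : bool) : x2 * x0 ^+ i = x0 ^+ i * x2.
    by case: i; rewrite ?expg0 ?mulg1 ?mul1g.
  have x2x1 : x2 * x1 = b ^+ (q * m).-1 by rewrite -bV invgM x1V x2V.
  case=> i [[] [k [l ->]]].
    exists i, false, ((q * m).-1 + k), l.
    by rewrite expg0 mulg1 expg1 !mulgA x2i expgnDr -x2x1 !mulgA.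
  exists i, true, k.+1, l; rewrite expg0 mulg1 expg1 expgS !mulgA x2i.
  by rewrite (involK _ x11).
Qed.

(** * Dihedral subgroups of bounded index in a 2-group *)

Lemma index2_sqr (gT : finGroupType) (G H : {group gT}) u :
  H \subset G -> #|G : H| %| 2 -> u \in G -> u ^+ 2 \in H.
Proof.
move=> sHG idx Gu; have [Hu|H'u] := boolP (u \in H); first exact: groupX.
have [_ /(_ _ idx)/orP[]/eqP iGH] := primeP (isT : prime 2).
  by case/negP: H'u; rewrite (index1g sHG iGH).
have GuH : u \in G :\: H by rewrite inE H'u.
apply: contraNT H'u => H'u2; have: u ^+ 2 \in H :* u.
  by rewrite (rcoset_index2 sHG iGH GuH) inE H'u2 groupX.
by rewrite mem_rcoset expg2 mulgK.
Qed.

(** A maximal subgroup M of G above D is normal of index 2, so it contains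
    the conjugate of D, with index at most 2, and also u; squares of elements of M
    lie in every subgroup of index at most 2. *)
Lemma sqr_mem_conj (gT : finGroupType) (G D : {group gT}) u g :
    2.-group G -> D \subset G -> #|G : D| %| 4 -> u \in D -> g \in G ->
  u ^+ 2 \in D :^ g.
Proof.
move=> pG sDG idx Du Gg.
have [eDG|[M maxM sDM]] := maximal_exists sDG.
  have /normP -> : g \in 'N(D) by rewrite (subsetP (normG _)) // (eDG : D :=: G).
  exact: groupX.
have iM := p_maximal_index pG maxM.
have sMG := maxgroupp maxM.
have nMg : M :^ g = M.
  by apply/normP; apply: subsetP (normal_norm (p_maximal_normal pG maxM)) _ Gg.
apply: (@index2_sqr _ M (D :^ g)%G).
- by rewrite -nMg conjSg.
- rewrite -[in #|M : _|]nMg indexJg -(@dvdn_pmul2l 2) // -[X in X * _ %| _]iM.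
  by rewrite Lagrange_index // (proper_sub sMG).
- exact: subsetP sDM _ Du.
Qed.

Section Dihedral.
Variables (gT : finGroupType) (x y : gT).
Hypotheses (xx : x ^+ 2 = 1) (yy : y ^+ 2 = 1).
Local Notation D := <<[set x; y]>>.

Lemma dihedral_mul : D = <[x * y]> * <[x]>.
Proof.
have nx : x \in 'N(<[x * y]>).
  by rewrite inE -cycleJ conj_invol_mull // cycleV.
have Dx : x \in D by rewrite mem_gen // set21.
have Dy : y \in D by rewrite mem_gen // set22.
rewrite -norm_joinEr ?cycle_subG //; apply/eqP; rewrite eqEsubset andbC.
rewrite (join_subG <[_]>%G) !cycle_subG groupM // Dx gen_subG /=.
have Jx : x \in <[x * y]> <*> <[x]> by rewrite mem_gen // inE cycle_id orbT.
rewrite subUset !sub1set Jx /= -[X in X \in _](mulKg x) (involV xx) groupM //.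
by rewrite mem_gen // inE cycle_id.
Qed.

(** Outside the rotation subgroup a dihedral group only has involutions.
    This is how an element of large order is recognised as a rotation. *)
Lemma dihedral_mem z : z \in D -> z \in <[x * y]> \/ z ^+ 2 = 1.
Proof.
rewrite dihedral_mul => /mulsgP[_ _ /cycleP[i ->] /cycleP[j ->] ->].
rewrite -(expg_mod_nat j xx) modn2; case: (odd j); last first.
  by left; rewrite mulg1 mem_cycle.
right; rewrite expg1 expg2 -mulgA -[X in _ * (X * _)](involV xx).
by rewrite -conjgE conjXg conj_invol_mull // expVgn mulgV.
Qed.

Lemma dihedral_card : 2 < #[x * y] -> #|D| = (2 * #[x * y])%N.
Proof.
move=> gt2; have nxa : x \notin <[x * y]>.
  apply: contraL gt2 => /cycleP[i xE]; rewrite -leqNgt dvdn_leq // order_dvdn.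
  have cax : commute (x * y) x.
    by have := commuteX i (commute_refl (x * y)); rewrite -xE.
  have := conj_invol_mull xx yy; rewrite conjgE cax mulKg expg2 => {2}->.
  by rewrite mulgV.
have ox : #[x] = 2.
  by apply: nt_prime_order => //; apply: contraNneq nxa => ->; apply: group1.
rewrite dihedral_mul TI_cardMg -?orderE ?ox 1?mulnC //.
by rewrite setIC prime_TIg -?orderE ?ox ?cycle_subG.
Qed.
End Dihedral.

(** The conjugates of [(x * y) ^+ 2] belong to the dihedral group <x, y> by
    [sqr_mem_conj]; their order exceeds 2, so they are rotations, and a cyclic
    group has only one subgroup of a given order. *)
Lemma sqr_cycle_normal (gT : finGroupType) (x y : gT) :
    2.-group [set: gT] -> x ^+ 2 = 1 -> y ^+ 2 = 1 -> 2 < #[(x * y) ^+ 2] ->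
    #|[set: gT]| %| 8 * #[x * y] ->
  <[(x * y) ^+ 2]> <| [set: gT].
Proof.
move=> pG xx yy oc dG; set D := <<[set x; y]>>; set c := (x * y) ^+ 2 in oc *.
have cardD : #|D| = (2 * #[x * y])%N.
  by apply: dihedral_card => //; apply: leq_trans oc (dvdn_leq _ (orderXdvd _ _)).
have aD : x * y \in D by rewrite groupM // mem_gen ?set21 ?set22.
have sDG : D \subset [set: gT] by apply: subsetT.
have iD : #|[set: gT] : D| %| 4.
  rewrite -(@dvdn_pmul2l #|D|) ?cardG_gt0 // Lagrange // cardD.
  by rewrite mulnAC.
apply/andP; split; first exact: subsetT.
apply/subsetP=> g _; rewrite inE -cycleJ.
have cgD : c ^ g \in D.
  have := sqr_mem_conj pG sDG iD aD (in_setT g^-1).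
  by rewrite mem_conjgV.
have cga : c ^ g \in <[x * y]>.
  have [//|cg2] := dihedral_mem xx yy cgD.
  move: oc; rewrite -(orderJ c g) ltnNge => /negP[]; apply: dvdn_leq => //.
  by rewrite order_dvdn cg2.
have -> // : <[c ^ g]> = <[c]>.
apply/eqP; rewrite (@eq_subG_cyclic _ <[x * y]>) ?cycle_cyclic ?cycle_subG ?mem_cycle //.
by rewrite -!orderE orderJ.
Qed.

(** * The relations with two twists *)

(** The common form of the six presentations: [e] and [e'] say where the
    involution [(x1 * x2) ^+ m] enters the two last relators. *)
Definition twist_relations (G : groupType) (x0 x1 x2 : G) (q m : nat) (e e' : bool) :=
  [/\ x0 ^+ 2 = 1, x1 ^+ 2 = 1, x2 ^+ 2 = 1, (x0 * x2) ^+ 2 = 1 &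
    [/\ (x0 * x1) ^+ (2 * m) = 1, (x1 * x2) ^+ (2 * m) = 1,
        (x0 * x1) ^+ q * (x1 * x2) ^+ q * (x1 * x2) ^+ m ^+ e = 1 &
        [~ (x0 * x1) ^+ 2, x2] * (x0 * x1) ^+ 4 * (x1 * x2) ^+ m ^+ e' = 1]].

(** The twist is invisible in a^m = (a^q)^(m/q), because m/q is even. *)
Lemma half_power_eq (G : groupType) (a b : G) q m (e : bool) :
    b ^+ (2 * m) = 1 -> a ^+ q * b ^+ q * b ^+ m ^+ e = 1 -> 2 * q %| m ->
  a ^+ m = b ^+ m.
Proof.
move=> b2m ab /dvdnP[k mE].
have z2 : b ^+ m ^+ 2 = 1 by rewrite -expgnA mulnC.
have aq : a ^+ q = (b ^+ (q + m * e))^-1.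
  by rewrite expgnDr (expgnA b) -[LHS]invgK; congr _^-1; apply: mulg1_eq; rewrite mulgA.
have -> : a ^+ m = (a ^+ q) ^+ (2 * k).
  by rewrite -expgnA mE; congr (_ ^+ _); rewrite (mulnC q) mulnA (mulnC k).
rewrite aq -[RHS](involV z2) expVgn -expgnA; congr _^-1.
have -> : ((q + m * e) * (2 * k) = m + 2 * m * (e * k))%N.
  rewrite mulnDl mulnACA (mulnC m); congr (_ + _)%N.
  by rewrite [RHS]mE !(mulnCA _ 2) (mulnC q).
by rewrite expgnDr (expgnA b (2 * m)) b2m expg1n mulg1.
Qed.

(** The bound on the order of a presented group.  By [half_power_eq] the
    twisting element is a power of a^2, so that the last two relators express b^q
    and the conjugate of a^2 by x2 as powers of a^2. *)
Lemma twist_normal_form (G : groupType) (x0 x1 x2 : G) q m e e' :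
    generated_by x0 x1 x2 -> twist_relations x0 x1 x2 q m e e' ->
    0 < q -> 0 < m -> 2 %| q -> 2 * q %| m ->
  forall x, exists u : bool * bool * 'I_q * 'I_m,
    x = x0 ^+ u.1.1.1 * x1 ^+ u.1.1.2 * (x1 * x2) ^+ u.1.2 * (x0 * x1) ^+ 2 ^+ u.2.
Proof.
move=> gen [x00 x11 x22 x02 [a2m b2m abq ac]] q0 m0 q2 qm.
have zE := half_power_eq b2m abq qm.
set a := x0 * x1 in zE abq ac a2m *; set b := x1 * x2 in zE abq ac b2m *.
set c := a ^+ 2 in ac *.
have cm : c ^+ m = 1 by rewrite -expgnA.
pose cpow y := exists l, y = c ^+ l.
have cpowM y z : cpow y -> cpow z -> cpow (y * z).
  by case=> i -> [j ->]; exists (i + j); rewrite expgnDr.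
have cpowV y : cpow y -> cpow y^-1.
  case=> i ->; exists (m.-1 * i)%N.
  by rewrite expgnA -(expgV_nat m0 cm) expVgn.
have cpowX i : 2 %| i -> cpow (a ^+ i).
  by case/dvdnP=> k ->; exists k; rewrite mulnC expgnA.
have m2 : 2 %| m by apply: dvdn_trans qm; apply: dvdn_mulr.
have zpow f : cpow (b ^+ m ^+ nat_of_bool f).
  by case: f; [rewrite -zE; apply: cpowX | exists 0].
have [s cx2] : cpow (c ^ x2).
  have -> : c ^ x2 = c * (a ^+ 4 * b ^+ m ^+ e')^-1.
    rewrite -[LHS](mulKVg c) -commgEl; congr (_ * _).
    by rewrite -[RHS]mul1g -ac -(mulgA _ (a ^+ 4)) mulgK.
  apply: (cpowM _ _); first by exists 1%N.
  by apply: cpowV; apply: (cpowM _ _) => //; apply: cpowX.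
have [t bq] : cpow (b ^+ q).
  have -> : b ^+ q = (a ^+ q)^-1 * (b ^+ m ^+ e)^-1.
    by rewrite (@mulg1_eq _ _ (b ^+ q * b ^+ m ^+ e)) ?mulgK // mulgA.
  by apply: (cpowM _ _); apply: cpowV => //; apply: cpowX.
exact: normal_form gen x00 x11 x22 x02 q0 m0 cx2 bq cm.
Qed.

(** The order of c replaces the exponent m: comparing the two gives a lower
    bound for the order of c. *)
Lemma normal_form_card (gT : finGroupType) (x0 x1 x2 : gT) q m :
    (forall x : gT, exists u : bool * bool * 'I_q * 'I_m,
      x = x0 ^+ u.1.1.1 * x1 ^+ u.1.1.2 * (x1 * x2) ^+ u.1.2 * (x0 * x1) ^+ 2 ^+ u.2) ->
  #|[set: gT]| <= 4 * q * #[(x0 * x1) ^+ 2].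
Proof.
move=> nf; set c := (x0 * x1) ^+ 2 in nf *.
pose F (u : bool * bool * 'I_q * 'I_#[c]) :=
  x0 ^+ u.1.1.1 * x1 ^+ u.1.1.2 * (x1 * x2) ^+ u.1.2 * c ^+ u.2.
have <- : #|{: bool * bool * 'I_q * 'I_#[c]}| = (4 * q * #[c])%N.
  by rewrite !card_prod !card_ord card_bool.
apply: leq_trans (leq_imset_card F _).
apply/subset_leq_card/subsetP=> x _; have [[[[i j] r] l] ->] := nf x.
apply/imsetP; exists (i, j, r, Ordinal (ltn_pmod l (order_gt0 c))) => //=.
by rewrite /F /= expg_mod_order.
Qed.

(** * Maps whose order is small compared with the two rotation orders *)

Lemma gen_generated_by (gT : finGroupType) (x0 x1 x2 : gT) :
  <<[set x0; x1; x2]>> = [set: gT] -> generated_by x0 x1 x2.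
Proof.
move=> gen P P1 P_x0 P_x1 P_x2 x.
have /gen_prodgP[n [c Sc ->]] : x \in <<[set x0; x1; x2]>> by rewrite gen inE.
elim: n c Sc => [|n IH] c Sc; first by rewrite big_ord0.
rewrite big_ord_recl; have := Sc ord0; rewrite !inE -orbA.
by case/or3P=> /eqP ->; [apply: P_x0 | apply: P_x1 | apply: P_x2]; apply: IH.
Qed.

Lemma order_pow2 (gT : finGroupType) (x : gT) k :
  x ^+ (2 ^ k) != 1 -> x ^+ (2 * 2 ^ k) = 1 -> #[x] = (2 * 2 ^ k)%N.
Proof.
rewrite -expnS => nx1 /eqP; rewrite -order_dvdn => /(dvdn_pfactor _ _ (isT : prime 2)).
case=> j; rewrite leq_eqVlt ltnS => /predU1P[->//|le_jk] ox; case/negP: nx1.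
by rewrite -order_dvdn ox dvdn_exp2l.
Qed.

(** If (x0 x1)^m were trivial, (x0 x1)^2 would have order at most m/2 and the normal forms
    would be too few. *)
Lemma twist_order (gT : finGroupType) (x0 x1 x2 : gT) q k e e' :
    <<[set x0; x1; x2]>> = [set: gT] -> twist_relations x0 x1 x2 q (2 ^ k) e e' ->
    0 < q -> 2 %| q -> 2 * q %| 2 ^ k -> #|[set: gT]| = (4 * q * 2 ^ k)%N ->
  #[x0 * x1] = (2 * 2 ^ k)%N /\ #[x1 * x2] = (2 * 2 ^ k)%N.
Proof.
move=> gen rel q0 q2 qm cardG; have m0 : 0 < 2 ^ k by rewrite expn_gt0.
have [x00 x11 x22 x02 [a2m b2m abq ac]] := rel.
have zE := half_power_eq b2m abq qm.
have gen' := gen_generated_by gen.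
have nz : (x0 * x1) ^+ (2 ^ k) != 1.
  have m2 : 2 %| 2 ^ k by apply: dvdn_trans qm; apply: dvdn_mulr.
  apply/eqP=> am; have := normal_form_card (twist_normal_form gen' rel q0 m0 q2 qm).
  rewrite cardG leq_pmul2l ?muln_gt0 // leqNgt => /negP[].
  apply: (@leq_ltn_trans (2 ^ k %/ 2)); last by rewrite ltn_Pdiv.
  apply: dvdn_leq; first by rewrite divn_gt0 // dvdn_leq.
  by rewrite order_dvdn -expgnA mulnC divnK // am.
by split; apply: order_pow2; rewrite // -zE.
Qed.

(** Inversion commutes with every power map, so the action of [(x * y) ^+ 2]
    on <d> is the square of the action of [x], which is trivial. *)
Lemma sqr_comm_conj (G : groupType) (x y d : G) v :
    x ^+ 2 = 1 -> d ^ x = d ^+ v -> d ^ y = d^-1 -> commute ((x * y) ^+ 2) d.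
Proof.
move=> xx dx dy; have dvv : d ^+ v ^+ v = d.
  by rewrite -[RHS]conjg1 -xx expg2 conjgM dx conjXg dx.
have dxy : d ^ (x * y) = (d ^+ v)^-1 by rewrite conjgM dx conjXg dy expVgn.
apply/commute_sym/commgP; rewrite -conjg_fix expg2 conjgM dxy conjVg conjXg dxy.
by rewrite expVgn dvv invgK.
Qed.

Lemma sqr1_cycle (gT : finGroupType) (x y : gT) m :
    0 < m -> #[x] = (2 * m)%N -> y \in <[x]> -> y ^+ 2 = 1 ->
  exists e : bool, y = x ^+ m ^+ e.
Proof.
move=> m0 ox /cycleP[i ->] /eqP; rewrite -expgnA -order_dvdn ox [(i * 2)%N]mulnC.
rewrite dvdn_pmul2l // => /dvdnP[j ->]; exists (odd j).
rewrite mulnC -modn2 expgnA expg_mod_nat //.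
by rewrite -expgnA mulnC -ox expg_order.
Qed.

(** Squaring a^b = b^-2 a^-1 gives c^b = d^-1 (d^-1)^a c^-1.  When c^b = c z^i
    and d^a = d z^j with z central, this is c^2 d^2 = z^i z^j. *)
Lemma sqr_sqr_twist (G : groupType) (a b z : G) (i j : bool) :
    a ^ b = b ^- 2 * a^-1 -> z ^+ 2 = 1 -> commute a z -> commute b z ->
    [~ a ^+ 2, b] = z ^+ i -> [~ b ^+ 2, a] = z ^+ j ->
  a ^+ 2 ^+ 2 * b ^+ 2 ^+ 2 = z ^+ i * z ^+ j.
Proof.
move=> aJb z2 az bz; set c := a ^+ 2; set d := b ^+ 2 in aJb * => cb da.
have zf2 (f : bool) : z ^+ f * z ^+ f = 1 by rewrite -expg2 expgnAC z2 expg1n.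
have comz (u : G) n f : commute u z -> commute (z ^+ f) (u ^+ n).
  by move=> uz; apply/commuteX2/commute_sym.
have aVdV : a^-1 * d^-1 = z ^+ j * d^-1 * a^-1.
  rewrite conjgCV invgK conjVg -[d ^ a](mulKVg d) -commgEl da invgM.
  by rewrite (mulg1_eq (zf2 j)).
have cJb : c * z ^+ i = d^-1 * z ^+ j * d^-1 * c^-1.
  rewrite -cb mulKVg [c ^ b]conjXg aJb expg2 mulgA -(mulgA _ a^-1) aVdV.
  by rewrite (invgM a a : c^-1 = _) !mulgA.
have c2z : c ^+ 2 * z ^+ i = z ^+ j * d^-1 * d^-1.
  rewrite expg2 -mulgA -(comz _ 2 i az) mulgA cJb mulgVK; congr (_ * _).
  by apply/commute_sym/commuteV/comz.
rewrite -[c ^+ 2]mulg1 -(zf2 i) (mulgA (c ^+ 2) (z ^+ i)) c2z -(mulgA _ (z ^+ i)).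
have -> : z ^+ i * d ^+ 2 = d ^+ 2 * z ^+ i by rewrite -expgnA; apply: comz.
by clearbody c d; rewrite (expg2 d) !mulgA !(mulgVK d); apply: commuteX2.
Qed.

Section OrderBounds.
Variables (gT : finGroupType).
Local Notation G := [set: gT].

(** The heart of the classification.  The hypothesis on m excludes small
    groups in which x0 lies in <b><c>. *)
Lemma pow_mem_sqr_cycle (x0 x1 x2 : gT) q m :
    2.-group G -> x0 ^+ 2 = 1 -> x1 ^+ 2 = 1 -> x2 ^+ 2 = 1 -> (x0 * x2) ^+ 2 = 1 ->
    #|G| = (4 * q * m)%N -> q %| 4 -> 2 %| q -> 8 * q < m ->
    #[x0 * x1] = (2 * m)%N ->
    <[(x0 * x1) ^+ 2]> <| G -> <[(x1 * x2) ^+ 2]> <| G -> #[x1 * x2] = (2 * m)%N ->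
  commute ((x0 * x1) ^+ 2) ((x1 * x2) ^+ 2) /\ (x1 * x2) ^+ q \in <[(x0 * x1) ^+ 2]>.
Proof.
move=> pG x00 x11 x22 x02 cardG q4 q2 big oa nc nd ob.
set a := x0 * x1 in oa nc *; set b := x1 * x2 in ob nd *.
set c := a ^+ 2 in nc *; set d := b ^+ 2 in nd *.
have q0 : 0 < q by case: (q) q4.
have m0 : 0 < m by apply: leq_ltn_trans big.
have oc : #[c] = m by rewrite orderXdiv oa ?dvdn_mulr // mulKn.
have od : #[d] = m by rewrite orderXdiv ob ?dvdn_mulr // mulKn.
have x0V := involV x00.
have dx0 : d ^ x0 \in <[d]>.
  by rewrite memJ_norm ?cycle_id // (subsetP (normal_norm nd)) ?inE.
have dx1 : d ^ x1 = d^-1 by rewrite conjXg conj_invol_mull // expVgn.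
have cx0 : c ^ x0 = c^-1 by rewrite conjXg conj_invol_mull // expVgn.
have cd : commute c d by have /cycleP[v dv] := dx0; exact: sqr_comm_conj x00 dv dx1.
split=> //; apply/idPn=> nbq.
have Nc g : g \in 'N(<[c]>) by rewrite (subsetP (normal_norm nc)) ?inE.
have Nd g : g \in 'N(<[d]>) by rewrite (subsetP (normal_norm nd)) ?inE.
pose bb := coset <[c]> b; pose y0 := coset <[c]> x0; pose y1 := coset <[c]> x1.
have Qin g : coset <[c]> g \in G / <[c]> by apply: mem_quotient; rewrite inE.
have cardQ : #|G / <[c]>| = (4 * q)%N.
  by rewrite card_quotient ?normal_norm // -divgS ?subsetT // -orderE oc cardG mulnK.
have nq : ~~ (#[bb] %| q).
  apply: contra nbq; rewrite order_dvdn -morphX // => /eqP.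
  by apply: coset_idr.
have obb : 2 * q <= #[bb].
  have /p_natP[i oi] : 2.-elt bb by apply: mem_p_elt (Qin b); apply: quotient_pgroup.
  have [j _ qj] := dvdn_pfactor _ 2 (isT : prime 2) q4.
  rewrite qj -expnS oi leq_exp2l // ltnNge; apply: contra nq => le_ij.
  by rewrite oi qj dvdn_exp2l.
(* In the quotient by [<[c]>] the involution [x0] is central: [b ^ x0 = c * b]. *)
have bbx0 : bb ^ y0 = bb.
  have bx0 : b ^ x0 = c * b.
    rewrite conjgE x0V /c expg2 /a /b !mulgA (involK _ x11).
    by rewrite -!mulgA; do 2!congr (_ * _); move: (involV x02); rewrite invgM x0V involV.
  have := coset_kerl b (cycle_id c); rewrite -bx0 => E.
  by rewrite -morphJ.
(* [x1] inverts [b], so commuting with it would force the order of [bb] down to 2. *)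
have nby1 : y1 \notin 'C[bb].
  apply: contra nq => /cent1P cby1; rewrite order_dvdn.
  have bb2 : bb ^+ 2 = 1.
    have: bb ^ y1 = bb by rewrite conjgE -cby1 mulKg.
    by rewrite -morphJ // conj_invol_mull // morphV // expg2 => {1}<-; rewrite mulVg.
  by case/dvdnP: q2 => r ->; rewrite mulnC expgnA bb2 expg1n.
(* The centraliser of [bb] is proper, hence of order at most [2 * q]. *)
have y0bb : y0 \in <[bb]>.
  have -> : <[bb]> = 'C_(G / <[c]>)[bb].
    apply/eqP; rewrite eqEcard subsetI !cycle_subG Qin cent1id /= -orderE.
    apply: leq_trans obb; rewrite -(leq_pmul2l (isT : 0 < 2)) mulnA -[X in _ <= X]cardQ.
    have ltC : 'C_(G / <[c]>)[bb] \proper G / <[c]>.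
      rewrite properE subsetIl subsetIidl; apply: contra nby1 => /subsetP; apply.
      exact: Qin.
    rewrite -(Lagrange (proper_sub ltC)) mulnC leq_pmul2l ?cardG_gt0 //.
    by rewrite indexg_gt1 proper_subn.
  by rewrite inE Qin; apply/cent1P/commute_sym/commgP; rewrite -conjg_fix bbx0.
have x0d : commute x0 d.
  have /cycleP[i] := y0bb; rewrite -morphX // => /(kercoset_rcoset (Nc _) (Nc _)).
  case=> _ /cycleP[j ->] ->; apply/commute_sym/commuteM.
    by apply/commuteX/commute_sym.
  by apply/commute_sym/commuteX2.
(* [4 * q] is the order of the quotient by [<[d]>]. *)
have c4q : c ^+ (4 * q) \in <[d]>.
  apply: coset_idr => //; rewrite morphX //.
  have <- : #|G / <[d]>| = (4 * q)%N.
    by rewrite card_quotient ?normal_norm // -divgS ?subsetT // -orderE od cardG mulnK.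
  by rewrite expg_cardG // mem_quotient ?inE.
have : c ^+ (8 * q) = 1.
  have /cycleP[i c4qE] := c4q.
  have : (c ^+ (4 * q)) ^ x0 = c ^+ (4 * q).
    by rewrite c4qE; apply/eqP; rewrite conjg_fix; apply/commgP/commute_sym/commuteX.
  rewrite conjXg cx0 expVgn => /(congr1 ( *%g (c ^+ (4 * q)))).
  by rewrite mulgV -expgnDr addnn -mul2n mulnA.
move/eqP; rewrite -order_dvdn oc => /dvdn_leq.
by rewrite muln_gt0 q0 => /(_ isT); rewrite leqNgt big.
Qed.

(** Symmetry of the hypotheses under (x0, x1, x2) -> (x2, x1, x0) gives
    [pow_mem_sqr_cycle] in both directions; then all twists are elements of square 1
    in a cyclic group of order 2m, that is, powers of the involution
    z = (x1 x2)^m = (x0 x1)^m. *)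
Lemma order_twist (x0 x1 x2 : gT) q m :
    2.-group G -> x0 ^+ 2 = 1 -> x1 ^+ 2 = 1 -> x2 ^+ 2 = 1 -> (x0 * x2) ^+ 2 = 1 ->
    #|G| = (4 * q * m)%N -> q %| 4 -> 2 %| q -> 8 * q < m -> q %| m ->
    #[x0 * x1] = (2 * m)%N -> #[x1 * x2] = (2 * m)%N ->
  exists e e', twist_relations x0 x1 x2 q m e e'.
Proof.
move=> pG x00 x11 x22 x02 cardG q4 q2 big qm oa ob.
have q0 : 0 < q by case: (q) q4.
have m2 : 2 < m by apply: ltn_trans big; apply: (@leq_trans 8) => //; apply: leq_pmulr.
have m0 : 0 < m by apply: leq_trans m2.
have dG : #|G| %| 8 * (2 * m).
  by rewrite cardG mulnA dvdn_pmul2r // -[(8 * 2)%N]/(4 * 4)%N dvdn_pmul2l.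
have o2 x : #[x] = (2 * m)%N -> #[x ^+ 2] = m.
  by move=> ox; rewrite orderXdiv ox ?dvdn_mulr // mulKn.
have nc : <[(x0 * x1) ^+ 2]> <| G.
  by apply: sqr_cycle_normal; rewrite ?o2 ?oa.
have nd : <[(x1 * x2) ^+ 2]> <| G.
  by apply: sqr_cycle_normal; rewrite ?o2 ?ob.
have [cd bqc] := pow_mem_sqr_cycle pG x00 x11 x22 x02 cardG q4 q2 big oa nc nd ob.
(* Exchanging [x0] and [x2] replaces [a] by [b^-1] and [b] by [a^-1]. *)
have aqd : (x0 * x1) ^+ q \in <[(x1 * x2) ^+ 2]>.
  have ba : x2 * x1 = (x1 * x2)^-1 by rewrite invgM !involV.
  have ab : x1 * x0 = (x0 * x1)^-1 by rewrite invgM !involV.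
  have x20 : (x2 * x0) ^+ 2 = 1.
    by rewrite -[x2 * x0]invgK invgM !involV // expVgn x02 invg1.
  have := @pow_mem_sqr_cycle x2 x1 x0 q m pG x22 x11 x00 x20 cardG q4 q2 big.
  rewrite ba ab !orderV !expVgn !cycleV => /(_ ob nd nc oa)[_].
  by rewrite groupV.
set a := x0 * x1 in oa nc cd bqc aqd *; set b := x1 * x2 in ob nd cd bqc aqd *.
set c := a ^+ 2 in nc cd bqc *; set d := b ^+ 2 in nd cd aqd *.
have pow4 (u : gT) (H : {group gT}) : u ^+ q \in H -> u ^+ 2 ^+ 2 \in H.
  have /dvdnP[r E] : q %| 2 * 2 by [].
  by move=> uq; rewrite -expgnA E mulnC expgnA groupX.
have cb2 : commute b (c ^+ 2).
  by have /cycleP[i ->] := pow4 _ _ aqd; do 2!apply: commuteX.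
have ad2 : commute a (d ^+ 2).
  by have /cycleP[i ->] := pow4 _ _ bqc; do 2!apply: commuteX.
have Jmem (u v : gT) : <[u]> <| G -> u ^ v \in <[u]>.
  by move=> nu; rewrite memJ_norm ?cycle_id // (subsetP (normal_norm nu)) ?inE.
have sq1 (u v : gT) : <[u]> <| G -> commute v (u ^+ 2) -> [~ u, v] ^+ 2 = 1.
  move=> nu cvu; have /cycleP[i uv] := Jmem u v nu.
  rewrite commgEl expgMn; last by rewrite uv; apply/commuteX/commute_sym/commuteV.
  by rewrite -conjXg conjgE -cvu mulKg expVgn mulVg.
have memR (u v : gT) : <[u ^+ 2]> <| G -> [~ u ^+ 2, v] \in <[u]>.
  move=> nu; have := Jmem _ v nu; rewrite commgEl => /cycleP[i ->].
  by rewrite groupM ?groupV // !(mem_cycle, groupX) ?cycle_id.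
have zE : a ^+ m = b ^+ m.
  have [||e bmE] := sqr1_cycle m0 oa (y := b ^+ m).
  - case/dvdnP: qm => r ->; rewrite mulnC expgnA groupX //.
    by have /cycleP[i ->] := bqc; rewrite groupX // mem_cycle.
  - by rewrite -expgnA mulnC -ob expg_order.
  case: e bmE => [-> //|bm]; have : #[b] %| m by rewrite order_dvdn bm.
  by move/(dvdn_leq m0); rewrite ob leqNgt -{1}[m]mul1n ltn_pmul2r.
have [i cb] := sqr1_cycle m0 oa (memR _ b nc) (sq1 _ _ nc cb2).
have [j da] := sqr1_cycle m0 ob (memR _ a nd) (sq1 _ _ nd ad2).
rewrite zE in cb; set z := b ^+ m in zE cb da *.
have z2 : z ^+ 2 = 1 by rewrite -expgnA mulnC -ob expg_order.
have zf2 (f : bool) : z ^+ f * z ^+ f = 1 by rewrite -expg2 -expgnAC z2 expg1n.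
have za : commute a z by rewrite -zE; apply: commuteX.
have zb : commute b z by apply: commuteX.
have c2d2 : c ^+ 2 * d ^+ 2 = z ^+ i * z ^+ j.
  apply: sqr_sqr_twist => //.
  have abV : (a * b)^-1 = a * b by apply: involV; rewrite mulgA (involK _ x11).
  by rewrite conjgE -abV (invgM a b) mulgA -(invgM b b).
have [e abq] : exists e : bool, a ^+ q * b ^+ q * z ^+ e = 1.
  have [e ye] : exists e : bool, a ^+ q * b ^+ q = z ^+ e.
    apply: (sqr1_cycle m0 ob).
      by have /cycleP[r ->] := aqd; rewrite groupM // !(mem_cycle, groupX) ?cycle_id.
    have : q = 2 \/ q = 4.
      by case: (q) q4 q2 => [|[|[|[|[|]]]]] // *; [left | right].
    case=> qE; rewrite qE in aqd bqc *.
      (* Here [<[c]>] and [<[d]>] coincide and both commutators are trivial. *)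
      have /cycleP[r cE] := aqd; have /cycleP[t dE] := bqc.
      have zi : z ^+ i = 1.
        rewrite -cb; apply/eqP/commgP/commute_sym; rewrite cE.
        by do 2!apply: commuteX.
      have zj : z ^+ j = 1.
        rewrite -da; apply/eqP/commgP/commute_sym; rewrite dE.
        by do 2!apply: commuteX.
      by rewrite expgMn // c2d2 zi zj mulg1.
    have -> : a ^+ 4 = c ^+ 2 by rewrite -expgnA.
    have -> : b ^+ 4 = d ^+ 2 by rewrite -expgnA.
    rewrite c2d2 expgMn; last by apply: commuteX2.
    by rewrite !expg2 !zf2 mulg1.
  by exists e; rewrite ye zf2.
exists e, i; split=> //.
split=> //; [by rewrite -oa expg_order | by rewrite -ob expg_order |].
rewrite -/a -/b -/c -/z commgEl.
have -> : c ^ x2 = z ^+ i * c^-1.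
  have -> : x2 = x1 * b by rewrite mulgA -expg2 x11 mul1g.
  rewrite conjgM [c ^ x1]conjXg conj_invol_mulr // expVgn conjVg -/c.
  by rewrite -[c ^ b](mulKVg c) -commgEl cb invgM (mulg1_eq (zf2 i)).
have -> : a ^+ 4 = c * c by rewrite -(expgnDr a 2 2).
have zc : z ^+ i * c = c * z ^+ i.
  by apply/commute_sym/commuteX/commute_sym/commuteX/commute_sym.
clearbody c; rewrite !mulgA mulgVK -(mulgA _ (z ^+ i)) zc mulgA mulVg mul1g.
exact: zf2.
Qed.
End OrderBounds.

(** * Values of words and presented groups *)

Section Eval.
Variables (G : groupType) (x0 x1 x2 : G).

Definition word_val (w : word) : G :=
  \prod_(l <- w) (let x := nth 1 [:: x0; x1; x2] l.1 in if l.2 then x^-1 else x).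

Lemma word_valM u v : word_val (u * v) = word_val u * word_val v.
Proof. exact: big_cat. Qed.

Lemma word_val1 : word_val 1 = 1.
Proof. exact: big_nil. Qed.

Lemma word_valV u : word_val u^-1 = (word_val u)^-1.
Proof.
elim: u => [|l u IH]; first by rewrite [LHS]word_val1 [word_val _]word_val1 invg1.
have cons1 (t : 'I_3 * bool) (w : word) : (t :: w : word) = ([:: t] : word) * w by [].
rewrite cons1 invgM !word_valM IH invgM; congr (_ * _).
by rewrite /word_val !big_seq1 /=; case: l.2; rewrite ?invgK.
Qed.

Lemma word_valX u n : word_val (u ^+ n) = word_val u ^+ n.
Proof. by elim: n => [|n IH]; rewrite ?word_val1 // !expgS word_valM IH. Qed.

Lemma word_valR u v : word_val [~ u, v] = [~ word_val u, word_val v].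
Proof. by rewrite commgEl conjgE !word_valM !word_valV. Qed.

Lemma word_val_letter :
  ((word_val (letter (inord 0)) = x0) * (word_val (letter (inord 1)) = x1) *
   (word_val (letter (inord 2)) = x2))%type.
Proof. by rewrite /word_val !big_seq1 /= !inordK. Qed.

Definition satisfies (R : seq word) := forall r, r \in R -> word_val r = 1.

Lemma satisfiesE R : satisfies R <-> foldr (fun r P => word_val r = 1 /\ P) True R.
Proof.
elim: R => [|r R [IH1 IH2]] //=; split=> [satR|[r1 /IH2 satR] s].
  split; first by apply: satR; apply: mem_head.
  by apply: IH1 => s Rs; apply: satR; rewrite inE Rs orbT.
by rewrite inE => /predU1P[-> //|]; apply: satR.
Qed.

Lemma word_eq_val R u v : satisfies R -> word_eq R u v -> word_val u = word_val v.
Proof.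
move=> satR; elim=> //.
- by move=> u1 u2 u3 _ -> _ ->.
- by move=> u1 u2 v1 v2 _ Eu _ Ev; rewrite !word_valM Eu Ev.
- by move=> w; rewrite word_valM word_valV mulVg word_val1.
- by move=> r /satR ->; rewrite word_val1.
Qed.

End Eval.

Section PresentedTheory.
Variable R : seq word.
Local Notation rho i := (class_of R (letter (inord i))).

Lemma class_ofMg (u v : word) : class_of R (u * v) = class_of R u * class_of R v.
Proof. by rewrite -[LHS]class_ofM. Qed.

Lemma class_of_val u : class_of R u = word_val (rho 0) (rho 1) (rho 2) u.
Proof.
elim: u => [|[i b] u IH]; first by rewrite [RHS]word_val1.
have -> : ((i, b) :: u : word) = ([:: (i, b)] : word) * u by [].
rewrite word_valM class_ofMg IH; congr (_ * _).
have -> : class_of R [:: (i, b)] =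
    if b then (class_of R (letter i))^-1 else class_of R (letter i).
  by case: b => //; rewrite -[LHS]/(class_of R (letter i)^-1) -class_ofV.
rewrite /word_val big_seq1 /=.
have -> // : nth 1 [:: rho 0; rho 1; rho 2] i = class_of R (letter i).
by rewrite -[in RHS](inord_val i); case: i => [[|[|[|]]]].
Qed.

Lemma presented_satisfies : satisfies (rho 0) (rho 1) (rho 2) R.
Proof. by move=> r Rr; rewrite -class_of_val; apply/class_ofP/WordRelator. Qed.

Lemma presented_ind (P : presented R -> Prop) :
    P 1 -> (forall i (b : bool) x, P x -> P (class_of R [:: (i, b)] * x)) ->
  forall x, P x.
Proof.
move=> P1 PM x; rewrite -(class_of_repr x).
elim: (generic_quotient.repr x) => [//|[i b] u IH].
by rewrite -[_ :: _]/(([:: (i, b)] : word) * u) class_ofMg; apply: PM.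
Qed.

Lemma presented_generated_by :
    rho 0 ^+ 2 = 1 -> rho 1 ^+ 2 = 1 -> rho 2 ^+ 2 = 1 ->
  generated_by (rho 0) (rho 1) (rho 2).
Proof.
move=> r00 r11 r22 P P1 P0 P_1 P2; apply: presented_ind => // i b x Px.
have -> : class_of R [:: (i, b)] = class_of R (letter i).
  case: b => //; rewrite -[LHS](class_ofV R (letter i)).
  by rewrite -(inord_val i); case: i => [[|[|[|]]]] //= _; exact: involV.
by rewrite -(inord_val i); case: i => [[|[|[|]]]] //= _; auto.
Qed.

End PresentedTheory.

Section AutIso.
Variables (M : regular_map) (R : seq word).
Local Notation sat := (satisfies (map_r0 M) (map_r1 M) (map_r2 M)).
Local Notation val := (word_val (map_r0 M) (map_r1 M) (map_r2 M)).

Lemma Aut_iso_satisfies : Aut_iso M R -> sat R.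
Proof.
case=> f [bij_f f0 f1 f2] r Rr; apply: (bij_inj bij_f).
have f_1 : f 1 = 1 by apply: (mulgI (f 1)); rewrite -gmulfM !mulg1.
have fV x : f x^-1 = (f x)^-1.
  by apply: (mulgI (f x)); rewrite -gmulfM !mulgV.
have fval w : f (val w) = class_of R w.
  rewrite class_of_val /word_val; elim: w => [|l w IH]; first by rewrite !big_nil.
  rewrite !big_cons gmulfM IH; congr (_ * _).
  by case: l => [[[|[|[|i]]] Hi] []] //=; rewrite ?fV ?f0 ?f1 ?f2.
by rewrite fval f_1; apply/class_ofP/WordRelator.
Qed.

(** The relations give a morphism from the presented group onto Aut M.
    Its composite with an enumeration by a set no larger than Aut M is bijective,
    so the morphism itself is injective. *)
Lemma satisfies_Aut_iso (T : finType) (F : T -> presented R) :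
    sat R -> (forall p, exists t, p = F t) -> #|T| <= #|[set: Aut_map M]| ->
  Aut_iso M R.
Proof.
move=> satR F_surj le_card.
pose h (p : presented R) := val (generic_quotient.repr p).
have hE w : h (class_of R w) = val w by apply: word_eq_val satR (repr_class_of R w).
have hM p p' : h (p * p') = h p * h p'.
  by rewrite -(class_of_repr p) -(class_of_repr p') -class_ofMg !hE word_valM.
have h_surj g : exists t, h (F t) == g.
  suff [p <-] : exists p, h p = g by have [t ->] := F_surj p; exists t.
  move: g; apply: gen_generated_by (map_gen M) _ _ _ _ _ => [|_ [p <-]|_ [p <-]|_ [p <-]].
  - by exists (class_of R 1); rewrite hE word_val1.
  - by exists (class_of R (letter (inord 0)) * p); rewrite hM hE word_val_letter.
  - by exists (class_of R (letter (inord 1)) * p); rewrite hM hE word_val_letter.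
  - by exists (class_of R (letter (inord 2)) * p); rewrite hM hE word_val_letter.
have hF_inj : injective (h \o F).
  apply/injectiveP; rewrite /injectiveb /dinjectiveb -/(codom _); apply/card_uniqP.
  apply/eqP; rewrite size_codom eqn_leq; apply/andP; split.
    by rewrite -(size_codom (h \o F)) card_size.
  apply: leq_trans le_card _; apply/subset_leq_card/subsetP=> g _.
  by have [t /eqP <-] := h_surj g; apply: codom_f.
have h_inj : injective h.
  by move=> p p'; have [t ->] := F_surj p; have [t' ->] := F_surj p' => /hF_inj ->.
pose f g := F (xchoose (h_surj g)).
have fK : cancel f h by move=> g; apply/eqP/(xchooseP (h_surj g)).
have hK : cancel h f by move=> p; apply: h_inj; rewrite fK.
have fM : {morph f : x y / x * y} by move=> x y; apply: h_inj; rewrite hM !fK.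
pose fm : {multiplicative Aut_map M -> presented R} :=
  HB.pack f (isMultiplicative.Build _ _ f fM).
exists fm; split; first by exists h.
- by apply: h_inj; rewrite /= fK hE word_val_letter.
- by apply: h_inj; rewrite /= fK hE word_val_letter.
- by apply: h_inj; rewrite /= fK hE word_val_letter.
Qed.

End AutIso.

(** * The classification *)

Lemma twist_Aut_iso (M : regular_map) R q m e e' :
    (forall (G : groupType) (x0 x1 x2 : G),
      satisfies x0 x1 x2 R <-> twist_relations x0 x1 x2 q m e e') ->
    0 < q -> 0 < m -> 2 %| q -> 2 * q %| m -> map_order M = (4 * q * m)%N ->
  Aut_iso M R <-> twist_relations (map_r0 M) (map_r1 M) (map_r2 M) q m e e'.
Proof.
move=> R_twist q0 m0 q2 qm cardM; split=> [/Aut_iso_satisfies/R_twist //|relM].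
have relP := proj1 (R_twist _ _ _ _) (presented_satisfies (R := R)).
have [r00 r11 r22 _ _] := relP.
have nf := twist_normal_form (presented_generated_by r00 r11 r22) relP q0 m0 q2 qm.
apply: (satisfies_Aut_iso _ nf); first exact/R_twist.
by rewrite [X in _ <= X]cardM !card_prod !card_ord card_bool.
Qed.

Lemma twist_has_type (M : regular_map) q k :
    2 %| q -> q %| 4 -> 8 * q < 2 ^ k -> map_order M = (4 * q * 2 ^ k)%N ->
  has_type M (2 * 2 ^ k) (2 * 2 ^ k) <->
  exists e e', twist_relations (map_r0 M) (map_r1 M) (map_r2 M) q (2 ^ k) e e'.
Proof.
move=> q2 q4 big cardM; have q0 : 0 < q by case: (q) q4.
have k5 : 3 < k.
  by rewrite -(ltn_exp2l _ _ (isT : 1 < 2)); apply: leq_ltn_trans big; rewrite leq_pmulr.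
have qm : 2 * q %| 2 ^ k.
  apply: dvdn_trans (dvdn_exp2l 2 (ltnW k5)).
  by rewrite (@dvdn_pmul2l 2 q 4).
split=> [[oa ob]|[e [e' rel]]]; last exact: twist_order (map_gen M) rel q0 q2 qm cardM.
have invol (x : Aut_map M) : #[x] = 2 -> x ^+ 2 = 1 by move=> <-; apply: expg_order.
have pG : 2.-group [set: Aut_map M].
  by rewrite /pgroup [#|_|]cardM !pnatM (pnat_dvd q4) // pnatX.
apply: order_twist => //; try by [apply/invol/map_order0 | apply/invol/map_order1 |
  apply/invol/map_order2 | apply/invol/map_order02].
exact: dvdn_trans (dvdn_mull _ _) qm.
Qed.

(** For q = 2 the relator [a^2, x2] a^4 is redundant: a^2 is a power of b,
    which x2 inverts. *)
Lemma twist2_commg (G : groupType) (x1 x2 a : G) m (e : bool) :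
    x1 ^+ 2 = 1 -> x2 ^+ 2 = 1 -> a ^+ 2 * (x1 * x2) ^+ 2 * (x1 * x2) ^+ m ^+ e = 1 ->
  [~ a ^+ 2, x2] * a ^+ 4 = 1.
Proof.
move=> x11 x22; set b := x1 * x2 => abq.
have aE : a ^+ 2 = (b ^+ (2 + m * e))^-1.
  by rewrite expgnDr (expgnA b) -[LHS]invgK; congr _^-1; apply: mulg1_eq; rewrite mulgA.
rewrite commgEl {2}aE conjVg conjXg conj_invol_mulr // expVgn -aE.
by rewrite (expgnDr a 2 2) mulgA mulgVK mulVg.
Qed.

Lemma exp2_sub k n : k < n -> (2 ^ (n - k) = 2 * 2 ^ (n - k.+1))%N.
Proof. by move=> lt_kn; rewrite -expnS subnSK. Qed.

Section Relators.
Variables (n : nat) (G : groupType) (x0 x1 x2 : G).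
Hypothesis n_gt3 : 3 < n.
Local Notation sat := (satisfies x0 x1 x2).
Local Notation twist := (twist_relations x0 x1 x2).
Let E1 : (2 ^ (n - 2) = 2 * 2 ^ (n - 3))%N := exp2_sub (ltnW n_gt3).
Let E2 : (2 ^ (n - 3) = 2 * 2 ^ (n - 4))%N := exp2_sub n_gt3.
Let valE := (word_valM, word_valX, word_valR, word_val_letter).

Lemma satisfies_G1 : sat (G1_rel n) <-> twist 2 (2 ^ (n - 3)) false false.
Proof.
rewrite satisfiesE /= !valE E1 /twist_relations !expg0 !mulg1.
split=> [[x00 [x11 [x22 [x02 [a2m [b2m [ab _]]]]]]]|]; last first.
  by case=> x00 x11 x22 x02 [a2m b2m ab _].
do 2!split=> //; apply: (twist2_commg (m := 0) (e := false) x11 x22).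
by rewrite mulg1.
Qed.

Lemma satisfies_G2 : sat (G2_rel n) <-> twist 2 (2 ^ (n - 3)) true false.
Proof.
rewrite satisfiesE /= !valE E1 /twist_relations !expg0 !mulg1.
split=> [[x00 [x11 [x22 [x02 [a2m [b2m [ab _]]]]]]]|]; last first.
  by case=> x00 x11 x22 x02 [a2m b2m ab _].
by do 2!split=> //; apply: (twist2_commg (e := true) x11 x22 ab).
Qed.

Lemma satisfies_G3 : sat (G3_rel n) <-> twist 4 (2 ^ (n - 4)) false false.
Proof.
rewrite satisfiesE /= !valE E2 /twist_relations !expg0 !mulg1.
by split=> [[? [? [? [? [? [? [? [? _]]]]]]]]|[? ? ? ? []]].
Qed.

Lemma satisfies_G4 : sat (G4_rel n) <-> twist 4 (2 ^ (n - 4)) false true.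
Proof.
rewrite satisfiesE /= !valE E2 /twist_relations !expg0 !mulg1.
by split=> [[? [? [? [? [? [? [? [? _]]]]]]]]|[? ? ? ? []]].
Qed.

Lemma satisfies_G5 : sat (G5_rel n) <-> twist 4 (2 ^ (n - 4)) true true.
Proof.
rewrite satisfiesE /= !valE E2 /twist_relations.
by split=> [[? [? [? [? [? [? [? [? _]]]]]]]]|[? ? ? ? []]].
Qed.

Lemma satisfies_G6 : sat (G6_rel n) <-> twist 4 (2 ^ (n - 4)) true false.
Proof.
rewrite satisfiesE /= !valE E2 /twist_relations !expg0 !mulg1.
by split=> [[? [? [? [? [? [? [? [? _]]]]]]]]|[? ? ? ? []]].
Qed.

End Relators.

Local Close Scope group_scope.

Theorem theorem4p3 (n : nat) (M : regular_map) :
  12 <= n -> map_order M = 2 ^ n ->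
  (has_type M (2 ^ (n - 2)) (2 ^ (n - 2)) <->
     Aut_iso M (G1_rel n) \/ Aut_iso M (G2_rel n)) /\
  (has_type M (2 ^ (n - 3)) (2 ^ (n - 3)) <->
     Aut_iso M (G3_rel n) \/ Aut_iso M (G4_rel n) \/
     Aut_iso M (G5_rel n) \/ Aut_iso M (G6_rel n)).
Proof.
move=> n12 cardM.
have n_gt3 : 3 < n by apply: leq_trans n12.
have E1 : 2 ^ (n - 2) = 2 * 2 ^ (n - 3) := exp2_sub (ltnW n_gt3).
have E2 : 2 ^ (n - 3) = 2 * 2 ^ (n - 4) := exp2_sub n_gt3.
have card1 : map_order M = (4 * 2 * 2 ^ (n - 3)).
  by rewrite cardM -(expnD 2 3) subnKC // (leq_trans _ n12).
have card2 : map_order M = (4 * 4 * 2 ^ (n - 4)).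
  by rewrite cardM -(expnD 2 4) subnKC // (leq_trans _ n12).
have big1 : 8 * 2 < 2 ^ (n - 3).
  by rewrite -[8 * 2]/(2 ^ 4) ltn_exp2l // ltn_subRL (leq_trans _ n12).
have big2 : 8 * 4 < 2 ^ (n - 4).
  by rewrite -[8 * 4]/(2 ^ 5) ltn_exp2l // ltn_subRL (leq_trans _ n12).
have m1 : 2 * 2 %| 2 ^ (n - 3).
  by rewrite (dvdn_exp2l 2 (_ : 2 <= n - 3)) // leq_subRL (leq_trans _ n12).
have m2 : 2 * 4 %| 2 ^ (n - 4).
  by rewrite (dvdn_exp2l 2 (_ : 3 <= n - 4)) // leq_subRL (leq_trans _ n12).
have m10 : 0 < 2 ^ (n - 3) by rewrite expn_gt0.
have m20 : 0 < 2 ^ (n - 4) by rewrite expn_gt0.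
have rel1 G x0 x1 x2 := @satisfies_G1 n G x0 x1 x2 n_gt3.
have rel2 G x0 x1 x2 := @satisfies_G2 n G x0 x1 x2 n_gt3.
have rel3 G x0 x1 x2 := @satisfies_G3 n G x0 x1 x2 n_gt3.
have rel4 G x0 x1 x2 := @satisfies_G4 n G x0 x1 x2 n_gt3.
have rel5 G x0 x1 x2 := @satisfies_G5 n G x0 x1 x2 n_gt3.
have rel6 G x0 x1 x2 := @satisfies_G6 n G x0 x1 x2 n_gt3.
split.
  rewrite (twist_Aut_iso rel1) // (twist_Aut_iso rel2) // E1.
  rewrite (twist_has_type _ _ _ card1) //.
  split=> [[e [e' [? ? ? ? [? ? ab _]]]]|[]rel]; last first.
  - by exists true, false.
  - by exists false, false.
  suff : twist_relations (map_r0 M) (map_r1 M) (map_r2 M) 2 (2 ^ (n - 3)) e false.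
    by case: e {ab}; [right | left].
  by split=> //; split=> //; rewrite mulg1; apply: twist2_commg ab.
rewrite (twist_Aut_iso rel3) // (twist_Aut_iso rel4) // (twist_Aut_iso rel5) //.
rewrite (twist_Aut_iso rel6) // E2 (twist_has_type _ _ _ card2) //.
split=> [[[] [[] rel]]|]; try tauto.
by case=> [|[|[|]]] rel; do 2!eexists; exact: rel.
Qed.
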